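(* Let $\mathbb K$ be a field of characteristic $0$ and $x\in\mathbb K$. Let $\gamma:\mathfrak g_{\mathcal T}\to\mathfrak g_{\mathcal D}$ be the unique pre-Lie algebra morphism from the pre-Lie algebra of rooted trees (with grafting product) to the pre-Lie algebra of dissection diagrams that sends the one-vertex tree $\bullet$ to the dissection diagram $a$ of degree $1$. Then the unique extension of $\gamma$ to a Hopf algebra morphism $\varphi:\mathcal H_{GL}=(\mathcal S(\mathfrak g_{\mathcal T}),\star,\Delta)\to \mathcal H_D^{\circledast}=(\mathcal S(\mathfrak g_{\mathcal D}),\star,\Delta)$ is given by $$\varphi(t_1\cdots t_n)=\varphi(t_1)\cdots\varphi(t_n)$$ for every forest $t_1\cdots t_n$ of rooted trees (products taken in the symmetric algebras), and $$\varphi(t)=L(\varphi(t_1)\cdots\varphi(t_k))$$ for every rooted tree $t=B(t_1\cdots t_k)$, where $L:\mathcal S(\mathfrak g_{\mathcal D})\to\mathfrak g_{\mathcal D}$ is the linear map $L(D_1\cdots D_m)=(D_1\cdots D_m)\circ a$, with $\circ$ the extended pre-Lie product on $\mathcal S(\mathfrak g_{\mathcal D})$.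
   Context: A left pre-Lie algebra is a vector space $\mathfrak g$ with a bilinear product $\circ$ such that $u\circ(v\circ w)-(u\circ v)\circ w=v\circ(u\circ w)-(v\circ u)\circ w$. Oudom–Guin structure. For a left pre-Lie algebra $\mathfrak g$, let $\mathcal S(\mathfrak g)$ be its symmetric algebra with its usual coproduct $\Delta$ (elements of $\mathfrak g$ primitive) and counit $\varepsilon$. The product $\circ$ is extended to $\mathcal S(\mathfrak g)$ by $1\circ u=u$, $u\circ 1=\varepsilon(u)1$, $(yu)\circ v=y\circ(u\circ v)-(y\circ u)\circ v$, $u\circ(vw)=\sum(u^{(1)}\circ v)(u^{(2)}\circ w)$ for $y\in\mathfrak g$, $u,v,w\in\mathcal S(\mathfrak g)$. With $u\star v=\sum u^{(1)}(u^{(2)}\circ v)$, $(\mathcal S(\mathfrak g),\star,\Delta)$ is a Hopf algebra isomorphic to the enveloping algebra of the Lie algebra associated with $\mathfrak g$. Rooted trees. $\mathfrak g_{\mathcal T}$ is the vector space spanned by (non-planar, nonempty) rooted trees, with $t_1\circ t_2=\sum_{s}\tau_{t_1,t_2,s}$, sum over vertices $s$ of $t_2$, where $\tau_{t_1,t_2,s}$ is obtained by grafting the root of $t_1$ on $s$. It is the free left pre-Lie algebra on $\bullet$. $B(t_1\cdots t_k)$ is the tree obtained by grafting $t_1,\dots,t_k$ on a common new root ($B(1)=\bullet$). Dissection diagrams. For $n\ge 0$ let $\Pi_n$ be the regular $(n+1)$-gon with vertices $0,1,\dots,n$ numbered clockwise; vertex $0$ is the root. For $0\le i\le n$, side $i$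 goes from vertex $i$ to vertex $i+1$ (with $n+1$ read as $0$). A chord is a segment joining two distinct vertices (adjacent vertices are allowed; such a chord is distinct from the side). A dissection diagram of degree $n$ is a set of $n$ pairwise non-crossing chords (they may share endpoints) of $\Pi_n$ forming an acyclic graph, hence a spanning tree on $\{0,\dots,n\}$. All chords are oriented towards the root. $\mathrm{Ch}(D)$ is the set of chords of $D$. The diagram of degree $0$ is identified with $1$. Coproduct. $\mathcal H_D$ is the commutative polynomial algebra on dissection diagrams of positive degree, with $\Delta(D)=\sum_{C\subset \mathrm{Ch}(D)}x^{k_C(D)}q_C(D)\otimes r_C(D)$ (with $x^0=1$), extended multiplicatively; it is a graded connected Hopf algebra. Here the $p=|C|$ chords of $C$ cut the polygon into $p+1$ faces; for a face $\alpha$ let $S_C(\alpha)$ be the (nonempty) set of sides of the polygon bordering $\alpha$. $q_C(D)$ is obtained by contracting every chord of $C$ to a point: each face $\alpha$ becomes a polygon with set of sides $S_C(\alpha)$, rooted at the starting vertex of its side of minimal label, carrying the chords of $D$ not in $C$ that lie in $\alpha$; this is a dissection diagram, and $q_C(D)$ is the product of these over all faces. $r_C(D)$ is the dissection diagram of degree $p$ obtained by keeping the chords of $C$ and contracting all sides which are not the minimal side of their face, the root being the image of $0$. $k_C(D)$ is the number of chords of $C$ whose orientation in $D$ is opposite to their orientation (towards the root) in $r_C(D)$. $\mathfrak g_{\mathcal D}$ is the vector space with basis the dissection diagrams of positive degree, with product $D_1\circ D_2=\sum_D c(D_1,D_2;D)\,D$, where $c(D_1,D_2;D)$ is the coefficient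 of $D_1\otimes D_2$ in $\Delta(D)$; it is a left pre-Lie algebra. The graded dual $\mathcal H_D^{\circledast}$ of $\mathcal H_D$ is isomorphic to, and identified with, $(\mathcal S(\mathfrak g_{\mathcal D}),\star,\Delta)$. *)

(* Defs.v *)
From HB Require Import structures.
From mathcomp Require Import all_boot generic_quotient ssralg finmap.
From mathcomp Require Export monalg.

Set Implicit Arguments.
Unset Strict Implicit.
Unset Printing Implicit Defensive.

Import GRing.Theory.
Local Open Scope ring_scope.

(* A vector space with basis [I] is [{malg K[I]}], the basis vector of [i]
   being [<< i >>]; its symmetric algebra is the polynomial algebra
   [{malg K[{cmonom I}]}]. The instances below turn pairs of monomials into
   monomials, so that [{malg K[M * N]}] is the algebra
   [{malg K[M]} (x) {malg K[N]}], with [<< (m, n) >>] for m (x) n. *)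
Section PairMonomial.
Variables M N : monomType.
Definition pair_mone : M * N := (mone, mone).
Definition pair_mmul (p q : M * N) : M * N := (mmul p.1 q.1, mmul p.2 q.2).

Fact pair_mmulA : associative pair_mmul.
Proof. by move=> [? ?] [? ?] [? ?]; rewrite /pair_mmul /= !mulmA. Qed.
Fact pair_mul1m : left_id pair_mone pair_mmul.
Proof. by move=> [? ?]; rewrite /pair_mmul /= !mul1m. Qed.
Fact pair_mulm1 : right_id pair_mone pair_mmul.
Proof. by move=> [? ?]; rewrite /pair_mmul /= !mulm1. Qed.
Fact pair_unitm p q :
  pair_mmul p q = pair_mone -> p = pair_mone /\ q = pair_mone.
Proof.
by move: p q => [? ?] [? ?] [] /unitm [-> ->] /unitm [-> ->].
Qed.

HB.instance Definition _ := Choice_isMonomialDef.Build (M * N)%type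
  pair_mmulA pair_mul1m pair_mulm1 pair_unitm.
End PairMonomial.

Section PairConomial.
Variables M N : conomType.
Fact pair_mmulC : commutative (@pair_mmul M N).
Proof.
by move=> [? ?] [? ?]; rewrite /pair_mmul /=; congr (_, _); apply: mulmC.
Qed.
HB.instance Definition _ :=
  MonomialDef_isConomialDef.Build (M * N)%type pair_mmulC.
End PairConomial.

Notation Sym K I := {malg K[{cmonom I}]}.
Notation Sym2 K I := {malg K[({cmonom I} * {cmonom I})%type]}.

Section Symmetric.
Variables (K : fieldType) (I : choiceType).

Definition lext (J : choiceType) (W : lmodType K) (h : J -> W)
    (u : {malg K[J]}) : W :=
  \sum_(j <- msupp u) u@_j *: h j.

Definition bilext (J J' : choiceType) (W : lmodType K) (h : J -> J' -> W)
    (u : {malg K[J]}) (v : {malg K[J']}) : W :=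
  lext (fun j => lext (h j) v) u.

Definition svar (i : I) : Sym K I := << ucm i >>.

Definition emb (y : {malg K[I]}) : Sym K I := lext svar y.

Definition tens (u v : Sym K I) : Sym2 K I :=
  bilext (fun m n => << (m, n) >>) u v.

(* [sweedler F (coprod u)] is \sum F u^(1) u^(2), for F bilinear *)
Definition sweedler (W : lmodType K) (F : Sym K I -> Sym K I -> W)
    (z : Sym2 K I) : W :=
  lext (fun p => F << p.1 >> << p.2 >>) z.

Definition counit (u : Sym K I) : K := u@_mone.

(* the algebra morphism for which every generator is primitive *)
Definition coprod (u : Sym K I) : Sym2 K I :=
  lext (fun m : {cmonom I} =>
    \prod_(i <- finsupp m) (tens (svar i) 1 + tens 1 (svar i)) ^+ (m i)) u.

Record oudom_guin (pl : {malg K[I]} -> {malg K[I]} -> {malg K[I]})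
    (og : Sym K I -> Sym K I -> Sym K I) : Prop := OudomGuin {
  og_linear_l : forall v, linear (og^~ v);
  og_linear_r : forall u, linear (og u);
  og_emb : forall y z, og (emb y) (emb z) = emb (pl y z);
  og_1l : forall u, og 1 u = u;
  og_1r : forall u, og u 1 = counit u *: 1;
  og_mull : forall y u v,
    og (emb y * u) v = og (emb y) (og u v) - og (og (emb y) u) v;
  og_mulr : forall u v w,
    og u (v * w) = sweedler (fun u1 u2 => og u1 v * og u2 w) (coprod u)
}.

Definition star (og : Sym K I -> Sym K I -> Sym K I) (u v : Sym K I) :
    Sym K I :=
  sweedler (fun u1 u2 => u1 * og u2 v) (coprod u).

End Symmetric.

Arguments svar K {I} i.

Section Morphisms.
Variables (K : fieldType) (I J : choiceType).

Definition prelie_morphism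
    (plI : {malg K[I]} -> {malg K[I]} -> {malg K[I]})
    (plJ : {malg K[J]} -> {malg K[J]} -> {malg K[J]})
    (g : {malg K[I]} -> {malg K[J]}) : Prop :=
  forall u v, g (plI u v) = plJ (g u) (g v).

(* A (linear) bialgebra morphism between Hopf algebras; compatibility with
   the antipodes is automatic. *)
Record hopf_morphism (ogI : Sym K I -> Sym K I -> Sym K I)
    (ogJ : Sym K J -> Sym K J -> Sym K J)
    (f : Sym K I -> Sym K J) : Prop := HopfMorphism {
  hopf_1 : f 1 = 1;
  hopf_star : forall u v, f (star ogI u v) = star ogJ (f u) (f v);
  hopf_counit : forall u, counit (f u) = counit u;
  hopf_coprod : forall u,
    coprod (f u) = sweedler (fun u1 u2 => tens (f u1) (f u2)) (coprod u)
}.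

End Morphisms.

Inductive ptree := PNode of seq ptree.

Fixpoint ptree_encode (t : ptree) : GenTree.tree unit :=
  let: PNode s := t in GenTree.Node 0 (map ptree_encode s).

Fixpoint ptree_decode (t : GenTree.tree unit) : ptree :=
  if t is GenTree.Node _ s then PNode (map ptree_decode s) else PNode [::].

Lemma ptree_ind_all (P : ptree -> Prop) :
  (forall s, (forall i, (i < size s)%N -> P (nth (PNode [::]) s i)) ->
     P (PNode s)) -> forall t, P t.
Proof.
move=> IH; fix F 1 => - [s]; apply: IH.
elim: s => [i|t s IHs]; first by move=> {F}; rewrite ltn0.
by case=> [_|i]; [apply: F | apply: IHs].
Qed.

Lemma ptree_encodeK : cancel ptree_encode ptree_decode.
Proof.
elim/ptree_ind_all => s IH /=; congr PNode; rewrite -map_comp.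
apply: (@eq_from_nth _ (PNode [::])); first by rewrite size_map.
move=> i; rewrite size_map => lti.
by rewrite (nth_map (PNode [::])) //= IH.
Qed.

HB.instance Definition _ := Countable.copy ptree (can_type ptree_encodeK).

(* equality up to a permutation of the children of every vertex *)
Fixpoint ptree_iso (t u : ptree) {struct t} : bool :=
  let: PNode s := t in let: PNode s' := u in
  has (fun r => all2 ptree_iso s r) (permutations s').

Section All2.
Variables (R : rel ptree).
Let x0 := PNode [::].

Lemma all2_nthP s r :
  reflect (size s = size r /\
           forall i, (i < size s)%N -> R (nth x0 s i) (nth x0 r i))
          (all2 R s r).
Proof.
elim: s r => [|t s IH] [|u r] /=; try by constructor; case.
  by constructor.
apply: (iffP andP) => [[Rtu /IH [-> H]]|[[sz] H]].
  by split=> // - [|i] // lti; apply: H.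
by split; [apply: (H 0%N) | apply/IH; split=> // i; apply: (H i.+1)].
Qed.

Lemma all2_perm s r r' : all2 R s r -> perm_eq r' r ->
  exists2 p, perm_eq p s & all2 R p r'.
Proof.
move=> /all2_nthP [sz H] /(perm_iotaP x0) [js pjs ->].
exists [seq nth x0 s j | j <- js].
  by rewrite -{2}[s](mkseq_nth x0); apply: perm_map; rewrite sz.
apply/all2_nthP; rewrite !size_map; split=> // i lti.
rewrite !(nth_map 0%N) //; apply: H.
by have := mem_nth 0%N lti; rewrite (perm_mem pjs) mem_iota sz.
Qed.
End All2.

Lemma ptree_isoP s s' :
  reflect (exists2 r, perm_eq r s' & all2 ptree_iso s r)
          (ptree_iso (PNode s) (PNode s')).
Proof.
apply: (iffP hasP) => -[r]; rewrite ?mem_permutations => p H; exists r => //.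
by rewrite mem_permutations.
Qed.

Lemma ptree_iso_refl : reflexive ptree_iso.
Proof.
elim/ptree_ind_all => s IH; apply/ptree_isoP; exists s => //.
exact/all2_nthP.
Qed.

Lemma ptree_iso_sym : symmetric ptree_iso.
Proof.
have imp : forall t u, ptree_iso t u -> ptree_iso u t.
  elim/ptree_ind_all => s IH [s'] /ptree_isoP [r prs' srr].
  have rs : all2 ptree_iso r s.
    case/all2_nthP: srr => sz H; apply/all2_nthP; split=> // i lti.
    by apply: IH; rewrite ?H ?sz.
  have srs : all2 (fun t u => ptree_iso u t) s r.
    case/all2_nthP: rs => sz H; apply/all2_nthP; split=> // i lti.
    by apply: H; rewrite sz.
  have [p pps ps'] := all2_perm srs (etrans (perm_sym _ _) prs').
  apply/ptree_isoP; exists p => //.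
  case/all2_nthP: ps' => sz H; apply/all2_nthP; split=> // i lti.
  by apply: H; rewrite sz.
by move=> t u; apply/idP/idP; apply: imp.
Qed.

Lemma ptree_iso_trans : transitive ptree_iso.
Proof.
move=> u t; elim/ptree_ind_all: t u => s IH [s'] [s''].
move=> /ptree_isoP [r prs' srr] /ptree_isoP [r' pr's'' s'r'].
have s'r'' : all2 (fun t u => ptree_iso u t) r' s'.
  case/all2_nthP: s'r' => sz H; apply/all2_nthP; split=> // i lti.
  by apply: H; rewrite sz.
have [p ppr' pr] := all2_perm s'r'' prs'.
apply/ptree_isoP; exists p; first exact: perm_trans ppr' pr's''.
case/all2_nthP: srr => sz H; case/all2_nthP: pr => sz' H'.
apply/all2_nthP; split=> [|i lti]; first by rewrite sz sz'.
by apply: (IH i lti (nth (PNode [::]) r i)); rewrite ?H // H' // sz' -sz.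
Qed.

Canonical ptree_iso_equiv :=
  EquivRel ptree_iso ptree_iso_refl ptree_iso_sym ptree_iso_trans.

Definition rtree := {eq_quot ptree_iso_equiv}%qT.
HB.instance Definition _ := Choice.on rtree.
HB.instance Definition _ := EqQuotient.on rtree.

(* the tree B(t_1 ... t_k), for s = [:: t_1; ...; t_k] *)
Definition Bplus (s : seq rtree) : rtree :=
  (\pi_rtree (PNode (map repr s)))%qT.

Definition bullet : rtree := Bplus [::].

(* all graftings of [t] on [u], one for each vertex of [u] *)
Fixpoint grafts (t u : ptree) {struct u} : seq ptree :=
  let: PNode s := u in
  PNode (t :: s) :: map PNode
    ((fix graft_below (s : seq ptree) : seq (seq ptree) :=
        if s is v :: s' then
          [seq v' :: s' | v' <- grafts t v] ++
          [seq v :: r | r <- graft_below s']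
        else [::]) s).

Definition tree_prod (K : fieldType) :
    {malg K[rtree]} -> {malg K[rtree]} -> {malg K[rtree]} :=
  bilext (fun t u : rtree =>
    \sum_(v <- grafts (repr t) (repr u)) << (\pi_rtree v)%qT >>).

(* Vertices and sides of the polygon with [n.+1] vertices are both elements of
   ['I_n.+1]; a chord is the set of its two endpoints. *)

Definition crossing n (c d : {set 'I_n.+1}) : bool :=
  [exists a in c, exists b in c, exists u in d, exists v in d,
     [&& a < u, u < b & b < v]%N].

Definition adj n (D : {set {set 'I_n.+1}}) : rel 'I_n.+1 :=
  fun u v => [set u; v] \in D.

(* a simple cycle has at most [n.+1] vertices; one of length 2 is a chord
   travelled back and forth *)
Definition acyclic n (D : {set {set 'I_n.+1}}) : bool :=
  [forall k : 'I_n.+2, forall p : k.-tuple 'I_n.+1,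
     ucycleb (adj D) p ==> (k <= 2)%N].

Definition is_dissection n (D : {set {set 'I_n.+1}}) : bool :=
  [&& #|D| == n,
      [forall c in D, #|c| == 2],
      [forall c in D, forall d in D, ~~ crossing c d]
    & acyclic D].

Record dissection n := Dissection {
  chords : {set {set 'I_n.+1}};
  chordsP : is_dissection chords
}.

HB.instance Definition _ n := [isSub for @chords n].
HB.instance Definition _ n := [Finite of dissection n by <:].

(* dissection diagrams of positive degree: [Tagged _ D] with
   [D : dissection n.+1] *)
Definition pdissection := {n : nat & dissection n.+1}.
HB.instance Definition _ := Choice.on pdissection.

Definition dissection_a_chords : {set {set 'I_2}} := [set setT].

Lemma dissection_a_subproof : is_dissection dissection_a_chords.
Proof.
apply/and4P; split.
- by rewrite cards1.
- by apply/forall_inP => c /set1P->; rewrite cardsT card_ord.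
- apply/forall_inP => c _; apply/forall_inP => d _.
  apply/negP => /exists_inP[a _ /exists_inP[b _ /exists_inP[u _]]].
  move=> /exists_inP[v _ /and3P[au ub bv]].
  have := leq_ltn_trans (leq_ltn_trans (leq_ltn_trans (leq0n a) au) ub) bv.
  by move=> /leq_ltn_trans/(_ (ltn_ord v)); case: (v : nat) bv ub => [|[|]].
- apply/forallP => k; apply/forallP => p; apply/implyP => /andP[_ /card_uniqP].
  by rewrite size_tuple => <-; rewrite -[leqRHS](card_ord 2) max_card.
Qed.

Definition dissection_a : pdissection :=
  Tagged (fun n => dissection n.+1) (Dissection dissection_a_subproof).

Section Coproduct.
Variable n : nat.
Implicit Types (c d : {set 'I_n.+1}) (C D : {set {set 'I_n.+1}}).
Implicit Types (i j u v : 'I_n.+1) (S : {set 'I_n.+1}).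

(* side i (from vertex i to i+1) lies between the endpoints a < b of c when
   a <= i < b; the chord c separates these sides from the other ones *)
Definition side_under c i : bool :=
  [exists a in c, (a <= i)%N] && [exists b in c, (i < b)%N].

Definition chord_under c d : bool :=
  [forall w in d, [exists a in c, (a <= w)%N] && [exists b in c, (w <= b)%N]].

(* two sides border the same face iff no chord of C separates them *)
Definition same_face C i j : bool :=
  [forall c in C, side_under c i == side_under c j].

(* every face is represented by the set of the sides bordering it *)
Definition faces C : {set {set 'I_n.+1}} :=
  equivalence_partition (same_face C) [set: 'I_n.+1].

Definition min_sides C : {set 'I_n.+1} :=
  [set i | [forall j, same_face C i j ==> (i <= j)%N]].

(* the chords of D outside C which lie in the face bordered by S *)
Definition chords_in C D S : {set {set 'I_n.+1}} :=
  [set d in D :\: C |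
     [forall c in C, forall s in S, chord_under c d == side_under c s]].

(* The polygon with set of sides S, numbered in increasing order, whose j-th
   vertex is the starting vertex of the j-th side. A vertex u is identified
   with the starting vertex of the first side in S met from u clockwise,
   possibly going past the root. *)
Definition contract_vertex S u : 'I_(#|S|.-1).+1 :=
  inord (#|[set s in S | (s < u)%N]| %% #|S|).

Definition contract S (E : {set {set 'I_n.+1}}) :
    {set {set 'I_(#|S|.-1).+1}} :=
  [set contract_vertex S @: d | d : {set 'I_n.+1} in E].

Definition rdiag C := contract (min_sides C) C.

(* in the tree D, the chord joining u and v is oriented from u to v: without
   it, v is still connected to the root *)
Definition toward m (D : {set {set 'I_m.+1}}) (u v : 'I_m.+1) : bool :=
  connect (adj (D :\ [set u; v])) v ord0.

Definition reversed C D c : bool :=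
  [exists u, exists v, [&& c == [set u; v], toward D u v
    & toward (rdiag C) (contract_vertex (min_sides C) v)
                       (contract_vertex (min_sides C) u)]].

Definition kdiag C D : nat := #|[set c in C | reversed C D c]|.

End Coproduct.

Section DissectionPreLie.
Variables (K : fieldType) (x : K).

(* A diagram as an element of H_D, the diagram of degree 0 being 1. The value 0
   is a default: it is not reached when E is a dissection diagram, as is the
   case of all the contractions below. *)
Definition diag_elt n : {set {set 'I_n.+1}} -> Sym K pdissection :=
  if n is m.+1 then fun E =>
    if insub E is Some D
    then svar K (Tagged (fun k => dissection k.+1) (D : dissection m.+1))
    else 0
  else fun=> 1.

Definition qdiag n (C D : {set {set 'I_n.+1}}) : Sym K pdissection :=
  \prod_(S in faces C) diag_elt (contract S (chords_in C D S)).

Definition dissection_coprod n (D : dissection n) : Sym2 K pdissection :=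
  \sum_(C : {set {set 'I_n.+1}} | C \subset chords D)
    x ^+ kdiag C (chords D) *: tens (qdiag C (chords D)) (diag_elt (rdiag C)).

Definition dissection_coef (D1 D2 D : pdissection) : K :=
  (dissection_coprod (tagged D))@_(ucm D1, ucm D2).

(* D1 o D2: since the coproduct is graded, only the D of degree
   deg D1 + deg D2 = (tag D1).+1 + (tag D2).+1 contribute *)
Definition dissection_prod :
    {malg K[pdissection]} -> {malg K[pdissection]} -> {malg K[pdissection]} :=
  bilext (fun D1 D2 =>
    \sum_(D : dissection (tag D1 + tag D2).+2)
      dissection_coef D1 D2 (Tagged (fun n => dissection n.+1) D) *:
      << (Tagged (fun n => dissection n.+1) D : pdissection) >>).

End DissectionPreLie.

(* Main.v *)
(* Since both Oudom-Guin structures exist, the two pre-Lie identities are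
   automatic, and only the formula (y u) o v = y o (u o v) - (y o u) o v is
   needed. For every element a, the map R_a : u |-> u o a takes values in the
   pre-Lie algebra and satisfies R_a(y u) = y o R_a(u) - R_a(y o u). As y o - is
   a derivation preserving the symmetric degree, this determines R_a by
   induction on the degree. The linear extension of a forest F to the tree B(F)
   satisfies the same recursion as R_bullet, by the definition of grafting;
   hence B(F) = F o bullet. Define gamma on trees by
   gamma(B(t_1 ... t_k)) = R_a(gamma(t_1) ... gamma(t_k)) and let phi be the
   algebra morphism extending it. The recursion gives by induction on u that
   gamma(t o u) = gamma(t) o gamma(u), then that phi commutes with the extended
   products, hence with the star products. Uniqueness of phi follows from
   y u = (y star u) - (y o u), where y o u has the same degree as u. *)
From HB Require Import structures.
Require Import Defs.
From mathcomp Require Import all_boot generic_quotient ssralg finmap.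

Set Implicit Arguments.
Unset Strict Implicit.
Unset Printing Implicit Defensive.

Import GRing.Theory.
Local Open Scope ring_scope.

(** * Linear extension and symmetric algebras *)

Section LinearExtension.
Variable K : fieldType.

(** Lets the library lemmas on bundled linear maps apply to plain functions, such as partial
    applications of [og]. *)
Definition pack_linear (U V : lmodType K) (f : U -> V) (fL : linear f) :
    {linear U -> V} :=
  HB.pack f (GRing.isLinear.Build K U V *:%R f fL).

Section LinearProp.
Variables (U V : lmodType K) (f : U -> V).
Hypothesis fL : linear f.

Lemma lin0 : f 0 = 0.
Proof. exact: linear0 (pack_linear fL). Qed.

Lemma linD : {morph f : u v / u + v}.
Proof. exact: linearD (pack_linear fL). Qed.

Lemma linB : {morph f : u v / u - v}.
Proof. exact: linearB (pack_linear fL). Qed.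

Lemma lin_sum (T : Type) (r : seq T) (F : T -> U) :
  f (\sum_(i <- r) F i) = \sum_(i <- r) f (F i).
Proof. exact: (raddf_sum (pack_linear fL)). Qed.

End LinearProp.

(** Coefficients outside the support vanish, so the sum may run over any larger finite set; elements
    with different supports then share one index set. *)
Lemma lextEw (J : choiceType) (W : lmodType K) (h : J -> W) (d : {fset J}) u :
  (msupp u `<=` d)%fset -> lext h u = \sum_(j <- d) u@_j *: h j.
Proof.
move=> le; rewrite /lext (big_fset_incl _ le) // => j _ /mcoeff_outdom ->.
by rewrite scale0r.
Qed.

Lemma lext_is_linear (J : choiceType) (W : lmodType K) (h : J -> W) :
  linear (lext h).
Proof.
move=> c u v; set d := (msupp (c *: u + v)%R `|` (msupp u `|` msupp v))%fset.
rewrite !(@lextEw _ _ _ d) ?fsubsetUl //.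
- rewrite scaler_sumr -big_split /=; apply: eq_bigr => j _.
  by rewrite mcoeffD mcoeffZ scalerDl scalerA.
- exact: fsubset_trans (fsubsetUr _ _) (fsubsetUr _ _).
- exact: fsubset_trans (fsubsetUl _ _) (fsubsetUr _ _).
Qed.

HB.instance Definition _ (J : choiceType) (W : lmodType K) (h : J -> W) :=
  GRing.isLinear.Build K {malg K[J]} W *:%R (lext h) (lext_is_linear h).

Lemma lextU (J : choiceType) (W : lmodType K) (h : J -> W) j :
  lext h << j >> = h j.
Proof. by rewrite (lextEw _ msuppU_le) big_seq_fset1 mcoeffUU scale1r. Qed.

Lemma malgZU (J : choiceType) (c : K) (j : J) :
  << c *g j >> = c *: << j >> :> {malg K[J]}.
Proof.
by apply/malgP => k; rewrite mcoeffZ !mcoeffU mulrnAr mulr1.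
Qed.

Lemma malg_ind_lin (J : choiceType) (Q : {malg K[J]} -> Prop) :
  Q 0 -> (forall c j u, Q u -> Q (c *: << j >> + u)) -> forall u, Q u.
Proof.
move=> Q0 QD u; rewrite [u]monalgE; elim/big_rec: _ => // j v _ Qv.
by rewrite malgZU; apply: QD.
Qed.

(* The basis vectors are abstracted as [b] since unification through their
   algebra structures can be very slow. *)
Lemma malg_eq_lin (J : choiceType) (W : lmodType K) (f g : {malg K[J]} -> W) :
  linear f -> linear g -> (forall j b, b = << j >> -> f b = g b) -> f =1 g.
Proof.
move=> fL gL eqfg; apply: malg_ind_lin.
  by rewrite (lin0 fL) (lin0 gL).
by move=> c j u eq_u; rewrite fL gL (eqfg j) ?eq_u.
Qed.

Lemma bilext_linear_l (J J' : choiceType) (W : lmodType K)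
    (h : J -> J' -> W) v : linear (bilext h ^~ v).
Proof. exact: lext_is_linear. Qed.

Lemma bilext_linear_r (J J' : choiceType) (W : lmodType K)
    (h : J -> J' -> W) u : linear (bilext h u).
Proof.
move=> c v w; rewrite /bilext /lext scaler_sumr -big_split /=.
apply: eq_bigr => j _; rewrite -!/(lext _ _) linearP scalerDr !scalerA.
by rewrite mulrC.
Qed.

Lemma bilextU (J J' : choiceType) (W : lmodType K) (h : J -> J' -> W) j j' :
  bilext h << j >> << j' >> = h j j'.
Proof. by rewrite /bilext !lextU. Qed.

Lemma malgUM (M : monomType) (m n : M) :
  << m >> * << n >> = << mmul m n >> :> {malg K[M]}.
Proof. by rewrite malgM_def fgmulUU mulr1. Qed.

Lemma lext_multiplicative (M : conomType) (A : algType K) (h : M -> A) :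
  {morph h : m n / mmul m n >-> m * n} -> {morph lext h : u v / u * v}.
Proof.
move=> hM u v; move: u; apply: malg_eq_lin => [c u w|c u w|m bm bmE].
- by rewrite mulrDl -scalerAl linearP.
- by rewrite linearP mulrDl scalerAl.
move: v; apply: malg_eq_lin => [c u w|c u w|n bn bnE].
- by rewrite mulrDr -scalerAr linearP.
- by rewrite linearP mulrDr scalerAr.
by rewrite bmE bnE malgUM !lextU hM.
Qed.

End LinearExtension.

(** * Symmetric algebras: monomials, universal property, coproduct *)

Section SymmetricAlgebra.
Variables (K : fieldType) (I : choiceType).
Implicit Types (i : I) (s : seq I) (m n : {cmonom I}).
Implicit Types (y : {malg K[I]}) (u v w : Sym K I).

HB.instance Definition _ :=
  GRing.isLinear.Build K {malg K[I]} (Sym K I) *:%R (@emb K I)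
    (lext_is_linear (@svar K I)).

HB.instance Definition _ v :=
  GRing.isLinear.Build K (Sym K I) (Sym2 K I) *:%R (tens v)
    (bilext_linear_r _ v).

HB.instance Definition _ (W : lmodType K) (F : Sym K I -> Sym K I -> W) :=
  GRing.isLinear.Build K (Sym2 K I) W *:%R (sweedler F) (lext_is_linear _).

HB.instance Definition _ :=
  GRing.isLinear.Build K (Sym K I) (Sym2 K I) *:%R (@coprod K I)
    (lext_is_linear _).

Lemma tens_linear_l v : linear (@tens K I ^~ v).
Proof. exact: bilext_linear_l. Qed.

Lemma tensU m n : tens << m >> << n >> = << (m, n) >> :> Sym2 K I.
Proof. exact: bilextU. Qed.

Lemma embU i : emb << i >> = svar K i.
Proof. exact: lextU. Qed.

Definition monom_of_seq s : {cmonom I} := \big[mmul/mone]_(i <- s) ucm i.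

Lemma monom_of_seqE s i : monom_of_seq s i = count_mem i s.
Proof.
rewrite /monom_of_seq; elim: s => [|j s IHs]; first by rewrite big_nil cm1.
by rewrite big_cons cmM cmU IHs.
Qed.

Lemma prod_svar s : \prod_(i <- s) svar K i = << monom_of_seq s >>.
Proof.
rewrite /monom_of_seq; elim: s => [|i s IHs].
  by rewrite !big_nil -mpolyC1E.
by rewrite big_cons [in RHS]big_cons IHs /svar malgUM; congr << _ *g _ >>.
Qed.

(** A monomial is a multiset of generators; listing it with multiplicities allows induction on the
    number of factors. The order of the list is arbitrary. *)
Definition seq_of_monom m : seq I :=
  flatten [seq nseq (m i) i | i <- finsupp m].

Lemma count_seq_of_monom m i : count_mem i (seq_of_monom m) = m i.
Proof.
rewrite /seq_of_monom count_flatten -map_comp sumnE big_map.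
have [im|im] := boolP (i \in finsupp m).
  rewrite (big_fsetD1 i) //= count_nseq /= eqxx mul1n big1_fset ?addn0 //.
  by move=> j; rewrite in_fsetD1 count_nseq /= => /andP[/negPf-> _].
rewrite big1_fset => [|j jm _]; first by apply/esym/eqP; rewrite cmE_eq0.
by rewrite /= count_nseq /=; case: eqP jm im => // -> ->.
Qed.

Lemma seq_of_monomK : cancel seq_of_monom monom_of_seq.
Proof.
by move=> m; apply/eqP/cmP => i; rewrite monom_of_seqE count_seq_of_monom.
Qed.

Lemma monom_of_seqK s : perm_eq (seq_of_monom (monom_of_seq s)) s.
Proof. by apply/allP => i _; rewrite /= count_seq_of_monom monom_of_seqE. Qed.

Lemma monomE m : << m >> = \prod_(i <- seq_of_monom m) svar K i.
Proof. by rewrite prod_svar seq_of_monomK. Qed.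

Lemma sym_ind (Q : Sym K I -> Prop) :
  (forall c u v, Q u -> Q v -> Q (c *: u + v)) -> Q 1 ->
  (forall i u, Q u -> Q (svar K i * u)) -> forall u, Q u.
Proof.
move=> QD Q1 QM.
have Q0 : Q 0 by have := QD (-1) 1 1 Q1 Q1; rewrite scaleN1r addNr.
apply: malg_ind_lin; first exact: Q0.
move=> c m u Qu; apply: QD; last exact: Qu.
rewrite monomE; elim: (seq_of_monom m) => [|i s IHs].
  rewrite big_nil; exact: Q1.
rewrite big_cons; exact: QM.
Qed.

Section Lift.
Variables (A : comAlgType K) (f : I -> A).

Definition mlift m : A := \prod_(i <- finsupp m) f i ^+ m i.

Lemma mliftEw (d : {fset I}) m :
  (finsupp m `<=` d)%fset -> mlift m = \prod_(i <- d) f i ^+ m i.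
Proof.
move=> le; rewrite /mlift (big_fset_incl _ le) // => i _.
by rewrite -cmE_eq0 => /eqP ->.
Qed.

Lemma mliftM : {morph mlift : m n / mmul m n >-> m * n}.
Proof.
move=> m n; rewrite !(@mliftEw (finsupp (mmul m n))) ?mdomD //.
- by rewrite -big_split; apply: eq_bigr => i _; rewrite cmM exprD.
- exact: fsubsetUr.
- exact: fsubsetUl.
Qed.

(** The algebra morphism given by the universal property of the symmetric algebra. *)
Definition symlift : Sym K I -> A := lext mlift.

HB.instance Definition _ :=
  GRing.isLinear.Build K (Sym K I) A *:%R symlift (lext_is_linear _).

Lemma symlift_monoid_morphism : monoid_morphism symlift.
Proof.
split; last exact: lext_multiplicative mliftM.
by rewrite /symlift lextU /mlift mdom1 big_seq_fset0.
Qed.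

HB.instance Definition _ :=
  GRing.isMonoidMorphism.Build (Sym K I) A symlift symlift_monoid_morphism.

Lemma symlift_svar i : symlift (svar K i) = f i.
Proof. by rewrite /symlift lextU /mlift mdomU big_seq_fset1 cmUU. Qed.

Lemma symlift_emb y : symlift (emb y) = lext f y.
Proof.
move: y; apply: malg_eq_lin => [c y z|c y z|i _ ->].
- by rewrite !linearP.
- by rewrite linearP.
by rewrite embU lextU symlift_svar.
Qed.

End Lift.

(** Holds by conversion, and makes the morphism lemmas on [symlift] available for the coproduct. *)
Lemma coprodE : @coprod K I =
  symlift (fun i => tens (svar K i) 1 + tens 1 (svar K i)).
Proof. by []. Qed.

Lemma coprod1 : coprod 1 = 1 :> Sym2 K I.
Proof. by rewrite coprodE rmorph1. Qed.

Lemma coprodM : {morph @coprod K I : u v / u * v}.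
Proof. by move=> u v; rewrite coprodE rmorphM. Qed.

Lemma coprod_emb y : coprod (emb y) = tens (emb y) 1 + tens 1 (emb y).
Proof.
move: y; apply: malg_eq_lin => [c y z|c y z|i _ ->].
- by rewrite !linearP.
- by rewrite !linearP tens_linear_l scalerDr addrACA.
by rewrite embU coprodE symlift_svar.
Qed.

Lemma tensM u v u' v' : tens u v * tens u' v' = tens (u * u') (v * v').
Proof.
move: u; apply: malg_eq_lin => [c u w|c u w|m bm bmE].
- by rewrite tens_linear_l mulrDl scalerAl.
- by rewrite mulrDl -scalerAl tens_linear_l.
move: v; apply: malg_eq_lin => [c u w|c u w|n bn bnE].
- by rewrite linearP mulrDl scalerAl.
- by rewrite mulrDl -scalerAl linearP.
move: u'; apply: malg_eq_lin => [c u w|c u w|m' bm' bm'E].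
- by rewrite tens_linear_l mulrDr scalerAr.
- by rewrite mulrDr -scalerAr tens_linear_l.
move: v'; apply: malg_eq_lin => [c u w|c u w|n' bn' bn'E].
- by rewrite linearP mulrDr scalerAr.
- by rewrite mulrDr -scalerAr linearP.
have -> : bm * bm' = << mmul m m' >> by rewrite bmE bm'E; exact: malgUM.
have -> : bn * bn' = << mmul n n' >> by rewrite bnE bn'E; exact: malgUM.
have -> : tens bm bn = << (m, n) >> by rewrite bmE bnE; exact: tensU.
have -> : tens bm' bn' = << (m', n') >> by rewrite bm'E bn'E; exact: tensU.
rewrite tensU; exact: malgUM.
Qed.

(** [sweedler] only evaluates [F] on pairs of monomials; bilinearity of [F] gives all pure
    tensors. *)
Lemma sweedler_tens (W : lmodType K) (F : Sym K I -> Sym K I -> W) u v :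
  (forall w, linear (F^~ w)) -> (forall w, linear (F w)) ->
  sweedler F (tens u v) = F u v.
Proof.
move=> Fl Fr; move: u; apply: malg_eq_lin => [c u w|c u w|m bm bmE].
- by rewrite tens_linear_l linearP.
- exact: Fl.
move: v; apply: malg_eq_lin => [c u w|c u w|n bn bnE].
- by rewrite !linearP.
- exact: Fr.
by rewrite bmE bnE tensU /sweedler lextU.
Qed.

Lemma sweedler_coprod_emb (W : lmodType K) (F : Sym K I -> Sym K I -> W) y :
  (forall w, linear (F^~ w)) -> (forall w, linear (F w)) ->
  sweedler F (coprod (emb y)) = F (emb y) 1 + F 1 (emb y).
Proof.
move=> Fl Fr; rewrite coprod_emb linearD.
by congr (_ + _); apply: sweedler_tens.
Qed.

(** The projection onto symmetric degree 1: the inner sum is [<< i >>] if [m] is the generator [i],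
    and empty or zero otherwise. *)
Definition proj : Sym K I -> {malg K[I]} :=
  lext (fun m => \sum_(i <- finsupp m | m == ucm i) << i >>).

HB.instance Definition _ :=
  GRing.isLinear.Build K (Sym K I) {malg K[I]} *:%R proj (lext_is_linear _).

Lemma proj_emb : cancel (@emb K I) proj.
Proof.
apply: malg_eq_lin => // [c y z|i b ->]; first by rewrite !linearP.
by rewrite embU /proj lextU mdomU big_mkcond big_seq_fset1 eqxx.
Qed.

End SymmetricAlgebra.

(** * Extended products on an abstract algebra *)

(* The extended product on [A] = S([V]), for an arbitrary algebra [A] generated
   by [V]: rewriting in a polynomial algebra can unfold its ring structure
   without end. The rule for [u o (v w)] is only kept for [u] in [V]. *)
Record og_algebra (K : fieldType) (V : lmodType K) (A : comAlgType K)
    (e : V -> A) (p : A -> V) (pl : V -> V -> V) (og : A -> A -> A) : Prop :=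
  OgAlgebra {
  oga_retract : cancel e p;
  oga_linear_e : linear e;
  oga_linear_p : linear p;
  oga_linear_l : forall v, linear (og^~ v);
  oga_linear_r : forall u, linear (og u);
  oga_e : forall y z, og (e y) (e z) = e (pl y z);
  oga_1l : forall u, og 1 u = u;
  oga_e1 : forall y, og (e y) 1 = 0;
  oga_Ml : forall y u v,
    og (e y * u) v = og (e y) (og u v) - og (og (e y) u) v;
  oga_eM : forall y v w,
    og (e y) (v * w) = og (e y) v * w + v * og (e y) w;
  oga_span : forall Q : A -> Prop,
    (forall c u v, Q u -> Q v -> Q (c *: u + v)) ->
    (forall s : seq V, Q (\prod_(y <- s) e y)) -> forall u, Q u
}.

Section OgAlgebra.
Variables (K : fieldType) (V : lmodType K) (A : comAlgType K).
Variables (e : V -> A) (p : A -> V) (pl : V -> V -> V) (og : A -> A -> A).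
Hypothesis ogP : og_algebra e p pl og.
Implicit Types (y z : V) (u v w : A).

Lemma e_inj : injective e.
Proof. exact: can_inj (oga_retract ogP). Qed.

(** Linearity of [pl] is inherited from [og] through the injection [e]. *)
Lemma pl_linear_l z : linear (pl^~ z).
Proof.
move=> c y y'; apply: e_inj => /=.
by rewrite -(oga_e ogP) !(oga_linear_e ogP) -!(oga_e ogP) (oga_linear_l ogP).
Qed.

Lemma pl_linear_r y : linear (pl y).
Proof.
move=> c z z'; apply: e_inj.
by rewrite -(oga_e ogP) !(oga_linear_e ogP) -!(oga_e ogP) (oga_linear_r ogP).
Qed.

(** The lists of factors of the terms in the Leibniz expansion of y o (z_1 ... z_n). *)
Fixpoint derive_seq y (s : seq V) : seq (seq V) :=
  if s is z :: s' then (pl y z :: s') :: map (cons z) (derive_seq y s')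
  else [::].

Lemma size_derive_seq y s : all (fun r => size r == size s) (derive_seq y s).
Proof. by elim: s => //= z s IHs; rewrite eqxx all_map. Qed.

Lemma og_e_prod y s :
  og (e y) (\prod_(z <- s) e z) =
  \sum_(r <- derive_seq y s) \prod_(z <- r) e z.
Proof.
elim: s => [|z s IHs] /=; first by rewrite !big_nil (oga_e1 ogP).
rewrite !big_cons (oga_eM ogP) (oga_e ogP) IHs big_map mulr_sumr.
by congr (_ + _); apply: eq_bigr => r _; rewrite big_cons.
Qed.

(* The term [(y o u) o v] in the definition of [(y u) o v] is handled by
   noting that [y o -] preserves the degree in the symmetric algebra. *)
Lemma og_ind (Q : A -> Prop) :
  (forall c u v, Q u -> Q v -> Q (c *: u + v)) -> Q 1 ->
  (forall y u, Q u -> Q (og (e y) u) -> Q (e y * u)) ->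
  forall u, Q u.
Proof.
move=> QD Q1 QM.
have Q0 : Q 0 by have := QD (-1) 1 1 Q1 Q1; rewrite scaleN1r addNr.
have Qsum (rs : seq (seq V)) :
    (forall r, r \in rs -> Q (\prod_(y <- r) e y)) ->
    Q (\sum_(r <- rs) \prod_(y <- r) e y).
  elim: rs => [|r rs IHrs] Qrs; first by rewrite big_nil.
  rewrite big_cons -[X in X + _]scale1r; apply: QD.
    by apply: Qrs; rewrite mem_head.
  by apply: IHrs => r' r'rs; apply: Qrs; rewrite inE r'rs orbT.
have Qprod n s : size s = n -> Q (\prod_(y <- s) e y).
  elim: n s => [|n IHn] [|y s] //= szs; first by rewrite big_nil.
  have {}szs : size s = n by case: szs.
  rewrite big_cons; apply: QM; first exact: IHn.
  rewrite og_e_prod; apply: Qsum => r /(allP (size_derive_seq y s)) /eqP szr.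
  by apply: IHn; rewrite szr.
by apply: (oga_span ogP) => // s; apply: Qprod.
Qed.

Section Raise.
Variable a : V.

Definition raise u : V := p (og u (e a)).

Lemma raise_linear : linear raise.
Proof.
by move=> c u v; rewrite /raise (oga_linear_l ogP) (oga_linear_p ogP).
Qed.

(** In (y u) o a = y o (u o a) - (y o u) o a both terms on the right lie in the image of [e] by
    induction, so u o a always does and [p] loses nothing. *)
Lemma e_raise u : e (raise u) = og u (e a).
Proof.
move: u; apply: og_ind => [c u v eq_u eq_v||y u eq_u eq_yu].
- by rewrite raise_linear (oga_linear_e ogP) eq_u eq_v (oga_linear_l ogP).
- by rewrite /raise (oga_1l ogP) (oga_retract ogP).
rewrite {1}/raise (oga_Ml ogP) -eq_u -eq_yu (oga_e ogP).
by rewrite -(linB (oga_linear_e ogP)) (oga_retract ogP).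
Qed.

Lemma raise1 : raise 1 = a.
Proof. by rewrite /raise (oga_1l ogP) (oga_retract ogP). Qed.

Lemma raiseM y u : raise (e y * u) = pl y (raise u) - raise (og (e y) u).
Proof.
apply: e_inj; rewrite (linB (oga_linear_e ogP)) -(oga_e ogP) !e_raise.
exact: oga_Ml ogP _ _ _.
Qed.

(** The recursion expresses the value at y u by the values at u and y o u, which are the two
    induction hypotheses of [og_ind]. *)
Lemma raise_unique (B : A -> V) : linear B -> B 1 = a ->
  (forall y u, B (e y * u) = pl y (B u) - B (og (e y) u)) -> B =1 raise.
Proof.
move=> BL B1 BM; apply: og_ind => [c u v eq_u eq_v||y u eq_u eq_yu].
- by rewrite BL eq_u eq_v raise_linear.
- by rewrite B1 raise1.
by rewrite BM raiseM eq_u eq_yu.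
Qed.

End Raise.
End OgAlgebra.

(** * Algebra morphisms and extended products *)

Section OgMorphism.
Variables (K : fieldType) (V V' : lmodType K) (A A' : comAlgType K).
Variables (e : V -> A) (p : A -> V) (pl : V -> V -> V) (og : A -> A -> A).
Variables (e' : V' -> A') (p' : A' -> V').
Variables (pl' : V' -> V' -> V') (og' : A' -> A' -> A').
Hypotheses (ogP : og_algebra e p pl og) (ogP' : og_algebra e' p' pl' og').
Variables (g : V -> V') (f : A -> A').
Hypotheses (fL : linear f) (f1 : f 1 = 1) (fM : {morph f : u v / u * v}).
Hypothesis fe : forall y, f (e y) = e' (g y).

Lemma morph_prod s : f (\prod_(y <- s) e y) = \prod_(y <- s) e' (g y).
Proof.
elim: s => [|y s IHs]; first by rewrite !big_nil f1.
by rewrite !big_cons fM fe IHs.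
Qed.

(** Both sides expand by the Leibniz rule. Compatibility of [g] is assumed only on the factors in
    [s], which suits an induction on trees, where it is known for subtrees only. *)
Lemma morph_og_e_prod y s :
  (forall z, z \in s -> g (pl y z) = pl' (g y) (g z)) ->
  f (og (e y) (\prod_(z <- s) e z)) =
  og' (e' (g y)) (f (\prod_(z <- s) e z)).
Proof.
elim: s => [|z s IHs] gpl.
  by rewrite big_nil f1 (oga_e1 ogP) (oga_e1 ogP') (lin0 fL).
rewrite big_cons fM (oga_eM ogP) (oga_eM ogP') fe (linD fL) !fM fe.
rewrite (oga_e ogP) fe gpl ?mem_head // (oga_e ogP') IHs // => t ts.
by apply: gpl; rewrite inE ts orbT.
Qed.

(** The case of u in [V] is the Leibniz rule on products; the recursion in the left argument then
    reduces the general case to it. *)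
Lemma morph_og : (forall y z, g (pl y z) = pl' (g y) (g z)) ->
  forall u v, f (og u v) = og' (f u) (f v).
Proof.
move=> gpl; apply: (og_ind ogP) => [c u w eq_u eq_w v|v|y u eq_u eq_yu v].
- by rewrite (oga_linear_l ogP) !fL (oga_linear_l ogP') eq_u eq_w.
- by rewrite (oga_1l ogP) f1 (oga_1l ogP').
have eq_y w : f (og (e y) w) = og' (f (e y)) (f w).
  move: w; apply: (oga_span ogP) => [c w w' eq_w eq_w'|s].
    by rewrite (oga_linear_r ogP) !fL (oga_linear_r ogP') eq_w eq_w'.
  by rewrite morph_og_e_prod ?fe.
rewrite (oga_Ml ogP) (linB fL) eq_y eq_u eq_yu eq_y.
by rewrite fM fe (oga_Ml ogP').
Qed.

Lemma morph_raise a : (forall y z, g (pl y z) = pl' (g y) (g z)) ->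
  forall u, g (raise e p og a u) = raise e' p' og' (g a) (f u).
Proof.
move=> gpl u; apply: (e_inj ogP').
by rewrite -fe (e_raise ogP) (e_raise ogP') morph_og // fe.
Qed.

Hypothesis gL : linear g.

(** The induction step on trees: y o R_a(u) = R_a(y u) + R_a(y o u), and [g] and [f] carry each term
    to its counterpart. *)
Lemma prelie_raise_prod a y s :
  (forall u, g (raise e p og a u) = raise e' p' og' (g a) (f u)) ->
  (forall z, z \in s -> g (pl y z) = pl' (g y) (g z)) ->
  let z := raise e p og a (\prod_(z <- s) e z) in g (pl y z) = pl' (g y) (g z).
Proof.
move=> graise gpl /=; rewrite graise.
have -> u : pl y (raise e p og a u) =
    raise e p og a (e y * u) + raise e p og a (og (e y) u).
  by rewrite (raiseM ogP) subrK.
rewrite (linD gL) !graise fM fe (raiseM ogP').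
by rewrite (morph_og_e_prod gpl) subrK.
Qed.

(** Since y u = (y star u) - (y o u), the value of [h] at y u is forced by its values at u and y o
    u. *)
Lemma morph_unique (star : A -> A -> A) (star' : A' -> A' -> A') (h : A -> A') :
  (forall y u, star (e y) u = e y * u + og (e y) u) ->
  (forall y u, star' (e' y) u = e' y * u + og' (e' y) u) ->
  linear h -> h 1 = 1 -> (forall y, h (e y) = e' (g y)) ->
  (forall u v, h (star u v) = star' (h u) (h v)) ->
  (forall y z, g (pl y z) = pl' (g y) (g z)) -> h =1 f.
Proof.
move=> starE starE' hL h1 he hstar gpl.
apply: (og_ind ogP) => [c u v eq_u eq_v||y u eq_u eq_yu].
- by rewrite hL fL eq_u eq_v.
- by rewrite h1 f1.
have := hstar (e y) u; rewrite he starE' starE (linD hL) eq_yu eq_u.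
by rewrite (morph_og gpl) fe => /addIr ->; rewrite fM fe.
Qed.

End OgMorphism.

(** * Grafting of rooted trees *)

Section Leibniz.
Variables (A : comNzRingType) (T : Type) (f d : T -> A).

(** The Leibniz expansion on the product of the [f t], where [d t] stands for the derivative of
    [f t]. *)
Fixpoint leibniz (s : seq T) : A :=
  if s is t :: s' then d t * \prod_(u <- s') f u + f t * leibniz s' else 0.

Lemma leibniz_cat s1 s2 :
  leibniz (s1 ++ s2) =
  leibniz s1 * \prod_(t <- s2) f t + \prod_(t <- s1) f t * leibniz s2.
Proof.
elim: s1 => [|t s1 IHs] /=; first by rewrite big_nil mul0r mul1r add0r.
by rewrite IHs big_cat big_cons /= mulrDl mulrDr !mulrA addrA.
Qed.

(** Writing the expansion as a fold over the pairs [(f t, d t)] shows that it depends on these pairs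
    only, so lists of different types can be compared. *)
Lemma leibniz_foldr s :
  (leibniz s, \prod_(t <- s) f t) =
  foldr (fun x y => (x.2 * y.2 + x.1 * y.1, x.1 * y.2)) (0, 1)
    [seq (f t, d t) | t <- s].
Proof. by elim: s => [|t s IHs]; rewrite ?big_nil ?big_cons //= -IHs. Qed.

End Leibniz.

Lemma eq_leibniz (A : comNzRingType) (T T' : Type) (f d : T -> A)
    (f' d' : T' -> A) s s' :
  [seq (f t, d t) | t <- s] = [seq (f' t, d' t) | t <- s'] ->
  leibniz f d s = leibniz f' d' s'.
Proof.
move=> eq_ss'; have := leibniz_foldr f d s.
by rewrite eq_ss' -leibniz_foldr => -[].
Qed.

Lemma leibniz_perm (A : comNzRingType) (T : eqType) (f d : T -> A) s s' :
  perm_eq s s' -> leibniz f d s = leibniz f d s'.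
Proof.
apply: catCA_perm_subst => s1 s2 s3.
rewrite !leibniz_cat !big_cat /= !mulrDr !mulrA addrCA.
by congr (_ * _ + (_ * _ + _ * _)); apply: mulrC.
Qed.

(** A name for the anonymous inner fixpoint of [grafts], to which it is convertible. *)
Definition graft_below (t : ptree) : seq ptree -> seq (seq ptree) :=
  fix graft_below (s : seq ptree) : seq (seq ptree) :=
    if s is v :: s' then
      [seq v' :: s' | v' <- grafts t v] ++ [seq v :: r | r <- graft_below s']
    else [::].

Lemma graftsE t s :
  grafts t (PNode s) = PNode (t :: s) :: map PNode (graft_below t s).
Proof. by []. Qed.

(** Grafting on a forest acts on one tree of the forest at a time, hence as a derivation. *)
Lemma sum_graft_below (A : comNzRingType) (f : ptree -> A) t s :
  \sum_(r <- graft_below t s) \prod_(v <- r) f v =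
  leibniz f (fun v => \sum_(v' <- grafts t v) f v') s.
Proof.
elim: s => [|v s IHs]; first by rewrite big_nil.
rewrite /= big_cat !big_map -IHs mulr_suml mulr_sumr.
by congr (_ + _); apply: eq_bigr => r _; rewrite big_cons.
Qed.

Local Notation pi t := (\pi_rtree t)%qT.

Lemma pi_iso t u : ptree_iso t u -> pi t = pi u.
Proof. by move=> tu; apply/eqmodP. Qed.

Lemma repr_pi_iso t : ptree_iso (repr (pi t)) t.
Proof. by apply/eqmodP; rewrite reprK. Qed.

Lemma Bplus_pi s : Bplus [seq pi t | t <- s] = pi (PNode s).
Proof.
apply/pi_iso/ptree_isoP; exists s => //; rewrite -map_comp.
by elim: s => //= t s ->; rewrite repr_pi_iso.
Qed.

Lemma Bplus_perm s s' : perm_eq s s' -> Bplus s = Bplus s'.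
Proof.
move=> ss'; apply/pi_iso/ptree_isoP; exists (map repr s).
  exact: perm_map.
by elim: (map repr s) => //= t r ->; rewrite ptree_iso_refl.
Qed.

(** Induction on a planar representative, whose children are then replaced by their classes. *)
Lemma rtree_ind (Q : rtree -> Prop) :
  (forall s, (forall t, t \in s -> Q t) -> Q (Bplus s)) -> forall t, Q t.
Proof.
move=> QB t; rewrite -[t]reprK; elim/ptree_ind_all: (repr t) => s IHs.
rewrite -Bplus_pi; apply: QB => _ /mapP[u us ->].
by rewrite -(nth_index (PNode [::]) us); apply: IHs; rewrite index_mem.
Qed.

Section GraftSum.
Variables (K : fieldType) (V : lmodType K) (A : comAlgType K).
Variables (e : V -> A) (b : rtree -> V) (B : A -> V).
Hypotheses (eL : linear e) (BL : linear B).
Hypothesis BE : forall s, B (\prod_(t <- s) e (b t)) = b (Bplus s).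

Definition graft_sum t u : V := \sum_(v <- grafts t u) b (pi v).

Let eb v : A := e (b (pi v)).

Lemma B_prod_pi s : B (\prod_(v <- s) eb v) = b (pi (PNode s)).
Proof. by rewrite -Bplus_pi -BE big_map. Qed.

(** The first term is the grafting on the root, the second collects the graftings on all other
    vertices. *)
Lemma graft_sum_PNode t s :
  graft_sum t (PNode s) =
  B (eb t * \prod_(v <- s) eb v) + B (leibniz eb (e \o graft_sum t) s).
Proof.
have -> : leibniz eb (e \o graft_sum t) s =
    \sum_(r <- graft_below t s) \prod_(v <- r) eb v.
  rewrite sum_graft_below; apply: eq_leibniz; apply: eq_map => v /=.
  by congr (_, _); exact: (lin_sum eL).
rewrite /graft_sum graftsE big_cons big_map -B_prod_pi big_cons.
congr (_ + _); rewrite (lin_sum BL).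
by apply: eq_bigr => r _; rewrite -B_prod_pi.
Qed.

(** Grafting descends to non-planar trees in its second argument: [u] becomes [u'] by replacing the
    children with isomorphic ones, then permuting them. *)
Lemma graft_sum_iso t u u' :
  ptree_iso u u' -> graft_sum t u = graft_sum t u'.
Proof.
elim/ptree_ind_all: u u' => s IHs [s'] /ptree_isoP[r rs' /all2_nthP[szr sr]].
(* The children of [s] and [r] are isomorphic position by position: their classes agree, and by
   induction so do their grafting sums. *)
have -> : graft_sum t (PNode s) = graft_sum t (PNode r).
  have eq_pi : map eb s = map eb r.
    apply: (@eq_from_nth _ 0); rewrite !size_map // => i lti.
    rewrite !(nth_map (PNode [::])) -?szr // /eb; congr (e (b _)).
    by apply/pi_iso/sr.
  rewrite !graft_sum_PNode -!(big_map eb xpredT id) eq_pi.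
  congr (_ + B _); apply: eq_leibniz.
  apply: (@eq_from_nth _ (0, 0)); rewrite !size_map // => i lti.
  rewrite !(nth_map (PNode [::])) -?szr //=; congr (_, e _).
    by rewrite /eb; congr (e (b _)); apply/pi_iso/sr.
  exact/IHs/sr.
rewrite !graft_sum_PNode (perm_big _ rs') /=.
by rewrite (leibniz_perm _ _ rs').
Qed.
End GraftSum.

Lemma og_leibniz (K : fieldType) (V : lmodType K) (A : comAlgType K)
    (e : V -> A) (p : A -> V) (pl : V -> V -> V) (og : A -> A -> A)
    (T : Type) (f : T -> V) y s :
  og_algebra e p pl og ->
  og (e y) (\prod_(t <- s) e (f t)) =
  leibniz (fun t => e (f t)) (fun t => e (pl y (f t))) s.
Proof.
move=> ogP; elim: s => [|t s IHs]; first by rewrite big_nil (oga_e1 ogP).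
by rewrite big_cons (oga_eM ogP) (oga_e ogP) IHs.
Qed.

(** * Maps defined by recursion on rooted trees *)

Section TreeMap.
Variables (V : Type) (R : seq V -> V).

Fixpoint ptree_map (t : ptree) : V :=
  let: PNode s := t in R (map ptree_map s).

Definition rtree_map (t : rtree) : V := ptree_map (repr t).
End TreeMap.

Section TreeMapPerm.
Variables (V : eqType) (R : seq V -> V).
Hypothesis R_perm : forall s s', perm_eq s s' -> R s = R s'.

Lemma ptree_map_iso t u : ptree_iso t u -> ptree_map R t = ptree_map R u.
Proof.
elim/ptree_ind_all: t u => s IHs [s'] /ptree_isoP[r rs' /all2_nthP[szr sr]] /=.
rewrite -(R_perm (perm_map _ rs')); congr (R _).
(* A default value for [nth]: [V] is only known to be inhabited through [R]. *)
have z0 : V := ptree_map R (PNode [::]).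
apply: (@eq_from_nth _ z0); rewrite !size_map // => i lti.
rewrite !(nth_map (PNode [::])) -?szr //; exact/IHs/sr.
Qed.

Lemma rtree_map_Bplus s : rtree_map R (Bplus s) = R (map (rtree_map R) s).
Proof.
by rewrite /rtree_map (ptree_map_iso (repr_pi_iso _)) /= -map_comp.
Qed.
End TreeMapPerm.

(** * Freeness of the pre-Lie algebra of rooted trees *)

Section FreePreLie.
Variables (K : fieldType) (V : lmodType K) (A : comAlgType K).
Variables (e : V -> A) (p : A -> V) (pl : V -> V -> V) (og : A -> A -> A).
Hypothesis ogP : og_algebra e p pl og.
Variables (b : rtree -> V) (B : A -> V).
Hypothesis BL : linear B.
Hypothesis BE : forall s, B (\prod_(t <- s) e (b t)) = b (Bplus s).
Hypothesis plE : forall t u, pl (b t) (b u) = graft_sum b (repr t) (repr u).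
Hypothesis b_span : forall Q : V -> Prop,
  (forall c y z, Q y -> Q z -> Q (c *: y + z)) -> (forall t, Q (b t)) ->
  forall y, Q y.
Hypothesis eb_span : forall Q : A -> Prop,
  (forall c u v, Q u -> Q v -> Q (c *: u + v)) ->
  (forall s, Q (\prod_(t <- s) e (b t))) -> forall u, Q u.

(** The grafting rule t o B(F) = B(t F) + B(t o F): the root of B(F) gives the first term, its other
    vertices the second. *)
Lemma pl_Bplus t s : pl (b t) (b (Bplus s)) =
  B (e (b t) * \prod_(u <- s) e (b u)) +
  B (og (e (b t)) (\prod_(u <- s) e (b u))).
Proof.
have eL := oga_linear_e ogP.
rewrite plE (graft_sum_iso eL BL BE _ (repr_pi_iso _)).
rewrite (graft_sum_PNode eL BL BE) big_map reprK.
have eq_u u : e (b (pi (repr u))) = e (b u) by rewrite reprK.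
rewrite (eq_bigr _ (fun u _ => eq_u u)) (og_leibniz _ _ _ ogP).
congr (_ + B _); elim: s => //= u s ->.
by rewrite big_map reprK (eq_bigr _ (fun u _ => eq_u u)) plE.
Qed.

(** That is, B(F) = F o bullet: by [pl_Bplus], [B] satisfies the recursion characterizing [raise],
    once linearity has reduced y to a tree and u to a forest. *)
Lemma Bplus_raise : B =1 raise e p og (b bullet).
Proof.
apply: (raise_unique ogP) => //; first by have := BE [::]; rewrite big_nil.
move=> y u; move: y; apply: b_span => [c y z eq_y eq_z|t].
  rewrite !(oga_linear_e ogP, mulrDl, scalerAl) -?scalerAl.
  rewrite (oga_linear_l ogP) !BL eq_y eq_z (pl_linear_l ogP).
  by rewrite scalerBr addrACA -opprD.
move: u; apply: eb_span => [c u v eq_u eq_v|s].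
  rewrite mulrDr -scalerAr (oga_linear_r ogP) !BL eq_u eq_v (pl_linear_r ogP).
  by rewrite scalerBr addrACA -opprD.
by rewrite BE pl_Bplus addrK.
Qed.

Variables (V' : lmodType K) (A' : comAlgType K).
Variables (e' : V' -> A') (p' : A' -> V').
Variables (pl' : V' -> V' -> V') (og' : A' -> A' -> A').
Hypothesis ogP' : og_algebra e' p' pl' og'.
Variable a : V'.

Section Morphism.
Variables (g : V -> V') (f : A -> A').
Hypotheses (gL : linear g) (fL : linear f) (f1 : f 1 = 1).
Hypotheses (fM : {morph f : u v / u * v}) (fe : forall y, f (e y) = e' (g y)).
Hypothesis gb : forall s,
  g (b (Bplus s)) = raise e' p' og' a (\prod_(t <- s) e' (g (b t))).

Lemma morph_bullet : g (b bullet) = a.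
Proof. by have := gb [::]; rewrite big_nil (raise1 ogP'). Qed.

Lemma morph_raise_bullet u :
  g (raise e p og (b bullet) u) = raise e' p' og' (g (b bullet)) (f u).
Proof.
rewrite -Bplus_raise morph_bullet; move: u.
apply: eb_span => [c u v eq_u eq_v|s].
  by rewrite BL gL fL (raise_linear ogP') eq_u eq_v.
rewrite BE gb; congr (raise _ _ _ _ _).
by rewrite -(big_map b xpredT e) (morph_prod f1 fM fe) big_map.
Qed.

(** Induction on the tree that receives the grafting, written as F o bullet, with y arbitrary. *)
Lemma morph_prelie y z : g (pl y z) = pl' (g y) (g z).
Proof.
move: z; apply: b_span => [c z z' eq_z eq_z'|].
  by rewrite (pl_linear_r ogP) !gL eq_z eq_z' (pl_linear_r ogP').
apply: rtree_ind => s IHs; rewrite -BE Bplus_raise -(big_map b xpredT e).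
apply: (prelie_raise_prod ogP ogP' fL f1 fM fe gL) => [u|_ /mapP[t ts ->]].
  exact: morph_raise_bullet.
exact: IHs.
Qed.
End Morphism.

(** The converse of [morph_prelie]: a pre-Lie morphism sending the one-vertex tree to [a] obeys the
    recursion, which will give uniqueness. *)
Lemma morph_Bplus (g : V -> V') (f : A -> A') :
  linear f -> f 1 = 1 -> {morph f : u v / u * v} ->
  (forall y, f (e y) = e' (g y)) ->
  (forall y z, g (pl y z) = pl' (g y) (g z)) -> g (b bullet) = a ->
  forall s, g (b (Bplus s)) = raise e' p' og' a (\prod_(t <- s) e' (g (b t))).
Proof.
move=> fL f1 fM fe gpl gb s.
rewrite -BE Bplus_raise (morph_raise ogP ogP' fL f1 fM fe) // gb.
by rewrite -(big_map b xpredT e) (morph_prod f1 fM fe) big_map.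
Qed.
End FreePreLie.

(** * Oudom-Guin structures on polynomial algebras *)

Section OudomGuin.
Variables (K : fieldType) (I : choiceType).
Variables (pl : {malg K[I]} -> {malg K[I]} -> {malg K[I]}).
Variables (og : Sym K I -> Sym K I -> Sym K I).
Hypothesis ogP : oudom_guin pl og.
Implicit Types (y z : {malg K[I]}) (u v w : Sym K I).

Lemma counit_linear c u v : counit (c *: u + v) = c * counit u + counit v.
Proof. by rewrite /counit mcoeffD mcoeffZ. Qed.

Lemma counit_emb y : counit (emb y) = 0.
Proof.
(* [K^o] is the field seen as a vector space over itself. *)
move: y; apply: (@malg_eq_lin _ _ K^o) => [c y z|c y z|i b ->].
- by rewrite linearP counit_linear.
- by rewrite scaler0 addr0.
by rewrite embU /counit mcoeffU cm1_eq1.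
Qed.

Lemma counitM u v : counit (u * v) = counit u * counit v.
Proof. exact: (rmorphM (mcoeff (@mone {cmonom I}))). Qed.

Lemma counit1 : counit (1 : Sym K I) = 1.
Proof. exact: (rmorph1 (mcoeff (@mone {cmonom I}))). Qed.

(** As [emb y] is primitive, the Sweedler sum in [og_mulr] has two terms, and 1 acts as the
    identity. *)
Lemma oudom_guin_embM y v w :
  og (emb y) (v * w) = og (emb y) v * w + v * og (emb y) w.
Proof.
pose F u1 u2 : Sym K I := og u1 v * og u2 w.
have Fl u : linear (F^~ u).
  by move=> c u1 u2; rewrite /F (og_linear_l ogP) mulrDl scalerAl.
have Fr u : linear (F u).
  by move=> c u1 u2; rewrite /F (og_linear_l ogP) mulrDr scalerAr.
rewrite (og_mulr ogP).
apply: etrans (@sweedler_coprod_emb _ _ _ F y Fl Fr) _; rewrite /F.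
by rewrite !(og_1l ogP).
Qed.

Lemma star_emb y u : star og (emb y) u = emb y * u + og (emb y) u.
Proof.
pose F u1 u2 : Sym K I := u1 * og u2 u.
have Fl w : linear (F^~ w) by move=> c u1 u2; rewrite /F mulrDl scalerAl.
have Fr w : linear (F w).
  by move=> c u1 u2; rewrite /F (og_linear_l ogP) mulrDr scalerAr.
apply: etrans (@sweedler_coprod_emb _ _ _ F y Fl Fr) _; rewrite /F.
by rewrite (og_1l ogP) mul1r.
Qed.

(** The index [i0] serves to obtain [Q 0], from 0 = -b + b for a basis vector b. *)
Lemma malg_span (i0 : I) (Q : {malg K[I]} -> Prop) :
  (forall c y z, Q y -> Q z -> Q (c *: y + z)) -> (forall i, Q << i >>) ->
  forall y, Q y.
Proof.
move=> QD Qb; apply: malg_ind_lin => [|c i y Qy]; last exact: QD.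
by have := QD (-1) _ _ (Qb i0) (Qb i0); rewrite scaleN1r addNr.
Qed.

Lemma sym_span (Q : Sym K I -> Prop) :
  (forall c u v, Q u -> Q v -> Q (c *: u + v)) ->
  (forall s, Q (\prod_(i <- s) emb << i >>)) -> forall u, Q u.
Proof.
move=> QD QP; have Q1 : Q 1 by have := QP [::]; rewrite big_nil.
have Q0 : Q 0 by have := QD (-1) 1 1 Q1 Q1; rewrite scaleN1r addNr.
apply: malg_ind_lin => [|c m u Qu]; first exact: Q0.
apply: QD; last exact: Qu.
rewrite monomE; have := QP (seq_of_monom m).
by under eq_bigr do rewrite embU.
Qed.

Lemma oudom_guin_og_algebra :
  @og_algebra K {malg K[I]} (Sym K I) (@emb K I) (@proj K I) pl og.
Proof.
split.
- exact: proj_emb.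
- exact: linearP.
- exact: linearP.
- exact: og_linear_l ogP.
- exact: og_linear_r ogP.
- exact: og_emb ogP.
- exact: og_1l ogP.
- by move=> y; rewrite (og_1r ogP) counit_emb scale0r.
- exact: og_mull ogP.
- exact: oudom_guin_embM.
- move=> Q QD QP; apply: sym_span => // s.
  by rewrite -(big_map (fun i => << i >>) xpredT (@emb K I)); apply: QP.
Qed.
End OudomGuin.

(** * The universal morphism *)

Section Trees.
Variable K : fieldType.

(** The linear map F |-> B(F); by [Bplus_perm] the order in which a monomial is listed is
    irrelevant. *)
Definition Bplus_lin : Sym K rtree -> {malg K[rtree]} :=
  lext (fun m => << Bplus (seq_of_monom m) >>).

Lemma Bplus_lin_linear : linear Bplus_lin.
Proof. exact: lext_is_linear. Qed.

Lemma Bplus_linE (s : seq rtree) :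
  Bplus_lin (\prod_(t <- s) @emb K rtree << t >>) = << Bplus s >>.
Proof.
under eq_bigr do rewrite embU.
by rewrite prod_svar /Bplus_lin lextU (Bplus_perm (monom_of_seqK s)).
Qed.

Lemma tree_prodE (t u : rtree) :
  @tree_prod K << t >> << u >> =
  graft_sum (fun v => << v >> : {malg K[rtree]}) (repr t) (repr u).
Proof. exact: bilextU. Qed.

End Trees.

(** * The Hopf algebra morphism extending a pre-Lie morphism *)

Section SymMorphism.
Variables (K : fieldType) (I J : choiceType).
Variable g : {malg K[I]} -> {malg K[J]}.
Hypothesis gL : linear g.

Definition symmap : Sym K I -> Sym K J := symlift (fun i => emb (g << i >>)).

HB.instance Definition _ := GRing.Linear.on symmap.
HB.instance Definition _ := GRing.RMorphism.on symmap.

Lemma symmap_emb y : symmap (emb y) = emb (g y).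
Proof.
rewrite /symmap symlift_emb; move: y; apply: malg_eq_lin => [|c y z|i b ->].
- exact: lext_is_linear.
- by rewrite gL linearP.
by rewrite lextU.
Qed.

Lemma symmap_linear : linear symmap.
Proof. exact: linearP. Qed.

Lemma symmapM : {morph symmap : u v / u * v}.
Proof. exact: rmorphM. Qed.

Lemma symmap1 : symmap 1 = 1.
Proof. exact: rmorph1. Qed.

Lemma symmap_svar i : symmap (svar K i) = emb (g << i >>).
Proof. exact: symlift_svar. Qed.

Lemma counit_symmap u : counit (symmap u) = counit u.
Proof.
move: u; apply: sym_ind => [c u v eq_u eq_v||i u eq_u].
- rewrite symmap_linear (counit_linear c u v) (counit_linear c (symmap u)).
  congr (_ * _ + _); [exact: eq_u|exact: eq_v].
- by rewrite symmap1 !counit1.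
by rewrite symmapM symmap_svar !counitM counit_emb -embU counit_emb !mul0r.
Qed.

(** The tensor square of [symmap]. *)
Definition symmap2 : Sym2 K I -> Sym2 K J :=
  sweedler (fun u1 u2 => tens (symmap u1) (symmap u2)).

Lemma symmap2_tens u v : symmap2 (tens u v) = tens (symmap u) (symmap v).
Proof.
pose F u1 u2 : Sym2 K J := tens (symmap u1) (symmap u2).
have Fl w : linear (F^~ w) by move=> c u1 u2; rewrite /F linearP tens_linear_l.
have Fr w : linear (F w) by move=> c u1 u2; rewrite /F !linearP.
exact: (sweedler_tens u v Fl Fr).
Qed.

Lemma tens1 (I' : choiceType) : tens 1 1 = 1 :> Sym2 K I'.
Proof. exact: tensU. Qed.

Lemma symmap2_1 : symmap2 1 = 1.
Proof. by rewrite -tens1 symmap2_tens symmap1 tens1. Qed.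

Lemma symmap2M : {morph symmap2 : z w / z * w}.
Proof.
apply: lext_multiplicative => m n.
have E (i j : {cmonom I}) :
    symmap << mmul i j >> = symmap << i >> * symmap << j >>.
  by apply: etrans (symmapM _ _); congr symmap; apply/esym/malgUM.
by apply: etrans (esym (tensM _ _ _ _)); congr tens; apply: E.
Qed.

Lemma symmap2_linear : linear symmap2.
Proof. exact: lext_is_linear. Qed.

Lemma coprod_symmap_emb y : coprod (symmap (emb y)) = symmap2 (coprod (emb y)).
Proof.
have eq1 : symmap2 (tens (emb y) 1) = tens (emb (g y)) 1.
  exact: etrans (symmap2_tens _ _) (congr2 (@tens K J) (symmap_emb y) symmap1).
have eq2 : symmap2 (tens 1 (emb y)) = tens 1 (emb (g y)).
  exact: etrans (symmap2_tens _ _) (congr2 (@tens K J) symmap1 (symmap_emb y)).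
rewrite symmap_emb !coprod_emb; apply/esym.
exact: etrans (linD symmap2_linear _ _) (congr2 +%R eq1 eq2).
Qed.

(** Both sides are algebra morphisms in u, and they agree on the generators, which are primitive
    with primitive images. *)
Lemma coprod_symmap u : coprod (symmap u) = symmap2 (coprod u).
Proof.
move: u; apply: sym_ind => [c u v eq_u eq_v||i u eq_u].
- have cL (I' : choiceType) : linear (@coprod K I') by exact: linearP.
  rewrite symmap_linear (cL J) (cL I) symmap2_linear.
  exact: (congr2 (fun z w => c *: z + w) eq_u eq_v).
- by rewrite symmap1 !coprod1 symmap2_1.
have eq_i : coprod (symmap (svar K i)) = symmap2 (coprod (svar K i)).
  by rewrite -embU; apply: coprod_symmap_emb.
rewrite symmapM !coprodM symmap2M; exact: (congr2 *%R eq_i eq_u).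
Qed.

Variables (plI : {malg K[I]} -> {malg K[I]} -> {malg K[I]}).
Variables (plJ : {malg K[J]} -> {malg K[J]} -> {malg K[J]}).
Variables (ogI : Sym K I -> Sym K I -> Sym K I).
Variables (ogJ : Sym K J -> Sym K J -> Sym K J).
Hypotheses (ogIP : oudom_guin plI ogI) (ogJP : oudom_guin plJ ogJ).
Hypothesis gpl : prelie_morphism plI plJ g.

Lemma symmap_og u v : symmap (ogI u v) = ogJ (symmap u) (symmap v).
Proof.
exact: (morph_og (oudom_guin_og_algebra ogIP) (oudom_guin_og_algebra ogJP)
  symmap_linear symmap1 symmapM symmap_emb gpl u v).
Qed.

(** Once the coproduct has been moved through [symmap], the claim is linear in the coproduct of u
    and can be checked on pairs of monomials. *)
Lemma symmap_star u v :
  symmap (star ogI u v) = star ogJ (symmap u) (symmap v).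
Proof.
rewrite /star coprod_symmap; move: (coprod u) => z.
pose F v1 v2 : Sym K J := v1 * ogJ v2 (symmap v).
have Fl w : linear (F^~ w) by move=> c u1 u2; rewrite /F mulrDl scalerAl.
have Fr w : linear (F w).
  by move=> c u1 u2; rewrite /F (og_linear_l ogJP) mulrDr scalerAr.
move: z; apply: malg_eq_lin => [c z w|c z w|m b ->].
- by rewrite !linearP.
- by rewrite /symmap2 !linearP.
rewrite /symmap2 /sweedler !lextU.
apply: etrans (esym (sweedler_tens _ _ Fl Fr)).
by rewrite symmapM symmap_og.
Qed.

Lemma symmap_hopf : hopf_morphism ogI ogJ symmap.
Proof.
split; [exact: symmap1|exact: symmap_star|exact: counit_symmap|].
exact: coprod_symmap.
Qed.

Lemma symmap_unique (h : Sym K I -> Sym K J) :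
  linear h -> hopf_morphism ogI ogJ h -> (forall y, h (emb y) = emb (g y)) ->
  h =1 symmap.
Proof.
move=> hL hP he.
exact: (morph_unique (oudom_guin_og_algebra ogIP) (oudom_guin_og_algebra ogJP)
  symmap_linear symmap1 symmapM symmap_emb (star_emb ogIP) (star_emb ogJP)
  hL (hopf_1 hP) he (hopf_star hP) gpl).
Qed.
End SymMorphism.

(** * The morphism determined by the image of the one-vertex tree *)

Section FreeMorphism.
Variables (K : fieldType) (J : choiceType) (a : {malg K[J]}).
Variables (ogT : Sym K rtree -> Sym K rtree -> Sym K rtree).
Hypothesis ogTP : oudom_guin (@tree_prod K) ogT.
Variables (pl : {malg K[J]} -> {malg K[J]} -> {malg K[J]}).
Variables (og : Sym K J -> Sym K J -> Sym K J).
Hypothesis ogP : oudom_guin pl og.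

Definition sym_raise (u : Sym K J) : {malg K[J]} :=
  raise (@emb K J) (@proj K J) og a u.

Lemma emb_sym_raise u : emb (sym_raise u) = og u (emb a).
Proof. exact: (e_raise (oudom_guin_og_algebra ogP)). Qed.

(** The recursion gamma(B(t_1 ... t_k)) = (gamma(t_1) ... gamma(t_k)) o a, taken as a definition. *)
Definition gamma_tree : rtree -> {malg K[J]} :=
  rtree_map (fun s => sym_raise (\prod_(y <- s) emb y)).

Definition gamma : {malg K[rtree]} -> {malg K[J]} := lext gamma_tree.

HB.instance Definition _ :=
  GRing.isLinear.Build K {malg K[rtree]} {malg K[J]} *:%R gamma
    (lext_is_linear _).

Lemma gamma_Bplus s :
  gamma << Bplus s >> = sym_raise (\prod_(t <- s) emb (gamma << t >>)).
Proof.
rewrite /gamma lextU /gamma_tree rtree_map_Bplus => [|s1 s2 s12].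
  rewrite big_map; apply: (congr1 sym_raise); apply: eq_bigr => t _.
  exact: (congr1 (@emb K J) (esym (lextU _ _))).
apply: (congr1 sym_raise); exact: perm_big.
Qed.

Let TP := oudom_guin_og_algebra ogTP.
Let JP := oudom_guin_og_algebra ogP.

Lemma gamma_bullet : gamma << bullet >> = a.
Proof. exact: (morph_bullet JP gamma_Bplus). Qed.

Lemma gamma_prelie : prelie_morphism (@tree_prod K) pl gamma.
Proof.
have gL : linear gamma by exact: linearP.
move=> y z.
apply: (@morph_prelie _ _ _ _ _ _ _ TP _ _ (@Bplus_lin_linear K) (@Bplus_linE K)
  (@tree_prodE K) (malg_span bullet) (@sym_span K rtree) _ _ _ _ _ _ JP a gamma
  (symmap gamma) gL (symmap_linear gamma) (symmap1 gamma) (@symmapM _ _ _ gamma)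
  (symmap_emb gL) gamma_Bplus y z).
Qed.

Lemma gamma_unique (g : {malg K[rtree]} -> {malg K[J]}) :
  linear g -> prelie_morphism (@tree_prod K) pl g -> g << bullet >> = a ->
  g =1 gamma.
Proof.
move=> gL gpl ga; apply: malg_eq_lin => [//|c y z|t b ->].
  by rewrite linearP.
have gB s : g << Bplus s >> = sym_raise (\prod_(t <- s) emb (g << t >>)).
  exact: (@morph_Bplus _ _ _ _ _ _ _ TP _ _ (@Bplus_lin_linear K)
    (@Bplus_linE K) (@tree_prodE K) (malg_span bullet) (@sym_span K rtree)
    _ _ _ _ _ _ JP a g (symmap g) (symmap_linear g) (symmap1 g)
    (@symmapM _ _ _ g) (symmap_emb gL) gpl ga).
move: t; apply: rtree_ind => s IHs; rewrite gB gamma_Bplus.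
apply: (congr1 sym_raise); apply: eq_big_seq => t ts.
exact: (congr1 (@emb K J) (IHs t ts)).
Qed.
End FreeMorphism.

(** * The extension of gamma to forests of rooted trees *)

Unset Implicit Arguments.

Theorem proposition31 (K : fieldType) (char0 : [pchar K] =i pred0) (x : K)
    (ogT : Sym K rtree -> Sym K rtree -> Sym K rtree)
    (ogT_spec : oudom_guin (@tree_prod K) ogT)
    (ogD : Sym K pdissection -> Sym K pdissection -> Sym K pdissection)
    (ogD_spec : oudom_guin (dissection_prod x) ogD) :
  exists gamma : {linear {malg K[rtree]} -> {malg K[pdissection]}},
    [/\ prelie_morphism (@tree_prod K) (dissection_prod x) gamma,
        gamma << bullet >> = << dissection_a >>
      & forall gamma' : {linear {malg K[rtree]} -> {malg K[pdissection]}},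
          prelie_morphism (@tree_prod K) (dissection_prod x) gamma' ->
          gamma' << bullet >> = << dissection_a >> -> gamma' =1 gamma] /\
  exists phi : {linear Sym K rtree -> Sym K pdissection},
    [/\ hopf_morphism ogT ogD phi,
        forall u, phi (emb u) = emb (gamma u)
      & forall phi' : {linear Sym K rtree -> Sym K pdissection},
          hopf_morphism ogT ogD phi' ->
          (forall u, phi' (emb u) = emb (gamma u)) -> phi' =1 phi] /\
  exists L : {linear Sym K pdissection -> {malg K[pdissection]}},
    [/\ forall s : seq pdissection,
          emb (L (\prod_(D <- s) svar K D)) =
          ogD (\prod_(D <- s) svar K D) (svar K dissection_a),
        forall s : seq rtree,
          phi (\prod_(t <- s) svar K t) = \prod_(t <- s) phi (svar K t)
      & forall s : seq rtree,
          phi (svar K (Bplus s)) = emb (L (\prod_(t <- s) phi (svar K t)))].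
Proof.
pose a : {malg K[pdissection]} := << dissection_a >>.
pose g : {linear _ -> _} := @gamma K pdissection a ogD.
have gpl : prelie_morphism (@tree_prod K) (dissection_prod x) g.
  exact (gamma_prelie a ogT_spec ogD_spec).
exists g; split.
  split=> //; first exact: (gamma_bullet a ogD_spec).
  move=> g' g'pl g'a; apply: (gamma_unique ogT_spec ogD_spec) => //.
  exact: linearP.
have gL : linear g by exact: linearP.
exists (symmap g : {linear _ -> _}); split.
  split; [exact: (symmap_hopf gL ogT_spec ogD_spec gpl)|exact: symmap_emb|].
  move=> h hP he; apply: (symmap_unique gL ogT_spec ogD_spec gpl) => //.
  exact: linearP.
have LL : linear (sym_raise a ogD).
  exact: (raise_linear (oudom_guin_og_algebra ogD_spec)).
(* The map L is u |-> u o a, already known to take values in the span of the diagrams. *)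
exists (pack_linear LL); split=> s.
- by rewrite -[svar K dissection_a]embU; apply: (emb_sym_raise a ogD_spec).
- exact: (rmorph_prod (symmap g)).
(* On a single tree phi is gamma, so the formula is the recursion defining gamma. *)
apply: etrans (symmap_svar g _) _.
apply: etrans (congr1 (@emb K _) (gamma_Bplus a ogD s)) _.
apply: (congr1 (fun z => emb (sym_raise a ogD z))).
by apply: eq_bigr => t _; apply/esym/symmap_svar.
Qed.
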